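(* Let $F:[t_0,t_1]\times\mathbb{C}^{n_1\times\dots\times n_d}\to\mathbb{C}^{n_1\times\dots\times n_d}$ satisfy $\mathrm{Re}\langle Y,F(t,Y)\rangle=0$ for all $Y$ and all $t$. Run the rank-augmenting TTN integrator (described in the context) on the maximal tree $\bar\tau$ with an orthonormal starting TTN $Y_{\bar\tau}^0$ of full tree rank, the function $F$, and any step $t_0<t_1$ (step size $h=t_1-t_0$). Then for every non-leaf subtree $\tau$ of $\bar\tau$, the rank-augmented result $\widehat Y_\tau^1$ of the call of the integrator at $\tau$ (top-level if $\tau=\bar\tau$, recursive otherwise) and the starting TTN $Y_\tau^0$ of that call satisfy $\|\widehat Y_\tau^1\|=\|Y_\tau^0\|$.
   Context: Tensor notation: for a tensor with modes indexed $0,1,\dots,m$, $\mathrm{mat}_i$ is the mode-$i$ matricization (rows indexed by the $i$th index) and $\mathrm{ten}_i$ its inverse; $A\times_i\mathbf{B}$ is the mode-$i$ product, $\mathrm{mat}_i(A\times_i\mathbf{B})=\mathbf{B}\,\mathrm{mat}_i(A)$; $\times_{i=1}^m$ denotes successive products in modes $1,\dots,m$; ${}^*$ is conjugate transpose; $\|\cdot\|$ and $\langle X,Y\rangle=\sum \overline{x}\,y$ are the Euclidean norm and inner product of the vectors of entries. Trees: given a finite leaf set $\mathcal{L}=\{1,\dots,d\}$, each leaf $l$ is a tree with leaf set $\{l\}$; if $\tau_1,\dots,\tau_m$ ($m\ge2$) are trees with pairwise disjoint leaf sets, the ordered tuple $\tau=(\tau_1,\dots,\tau_m)$ is a tree whose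 leaf set is their union; the $\tau_i$ are its direct subtrees, and subtrees are defined recursively ($\sigma\le\tau$, $\sigma<\tau$ if also $\sigma\ne\tau$). Fix a tree $\bar\tau$ with leaf set $\mathcal{L}$. Tree tensor networks (TTN): given dimensions $n_l$ and ranks $r_\sigma$ ($\sigma\le\bar\tau$, $r_{\bar\tau}=1$), basis matrices $\mathbf{U}_l\in\mathbb{C}^{n_l\times r_l}$ at leaves and connection tensors $C_\tau\in\mathbb{C}^{r_\tau\times r_{\tau_1}\times\dots\times r_{\tau_m}}$ of full multilinear rank at non-leaf subtrees $\tau=(\tau_1,\dots,\tau_m)$, set $X_l=\mathbf{U}_l^\top$, $X_\tau=C_\tau\times_0\mathbf{I}_{r_\tau}\times_{i=1}^m\mathbf{U}_{\tau_i}\in\mathcal{V}_\tau:=\mathbb{C}^{r_\tau\times n_{\tau_1}\times\dots\times n_{\tau_m}}$ with $n_\tau=\prod_i n_{\tau_i}$, and $\mathbf{U}_\tau=\mathrm{mat}_0(X_\tau)^\top\in\mathbb{C}^{n_\tau\times r_\tau}$; for a leaf, $\mathcal{V}_l:=\mathbb{C}^{r_l\times n_l}$. The TTN is orthonormal if every $\mathbf{U}_\sigma$, $\sigma<\bar\tau$, has orthonormal columns. Full tree rank means all connection tensors have full multilinear rank. $\mathcal{V}_{\bar\tau}$ is identified with $\mathbb{C}^{n_1\times\dots\times n_d}$. Reduced operators and starting values: for a non-leaf $\tau=(\tau_1,\dots,\tau_m)$, a function $F_\tau:[t_0,t_1]\times\mathcal{V}_\tau\to\mathcal{V}_\tau$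 and a starting TTN $Y_\tau^0=C_\tau^0\times_0\mathbf{I}_{r_\tau}\times_{i=1}^m\mathbf{U}_{\tau_i}^0$ with $\mathbf{U}_{\tau_i}^0=\mathrm{mat}_0(X_{\tau_i}^0)^\top$, compute QR decompositions $\mathrm{mat}_i(C_\tau^0)^\top=\mathbf{Q}_{\tau_i}^0\mathbf{S}_{\tau_i}^{0,\top}$, let $\mathbf{V}_{\tau_i}^0=\mathrm{mat}_i\big(\mathrm{ten}_i(\mathbf{Q}_{\tau_i}^{0,\top})\times_0\mathbf{I}_{r_\tau}\times_{j\ne i}\mathbf{U}_{\tau_j}^0\big)^\top$, prolongation $\pi_{\tau,i}(Y)=\mathrm{ten}_i\big((\mathbf{V}_{\tau_i}^0\mathrm{mat}_0(Y))^\top\big)$ for $Y\in\mathcal{V}_{\tau_i}$, restriction $\pi_{\tau,i}^\dagger(Z)=\mathrm{ten}_0\big((\mathrm{mat}_i(Z)\mathbf{V}_{\tau_i}^0)^\top\big)$ for $Z\in\mathcal{V}_\tau$, and set $F_{\tau_i}(t,Y)=\pi_{\tau,i}^\dagger(F_\tau(t,\pi_{\tau,i}(Y)))$ and $Y_{\tau_i}^0=X_{\tau_i}^0\times_0\mathbf{S}_{\tau_i}^{0,\top}$. Rank-augmenting TTN integrator on $(\tau,Y_\tau^0,F_\tau,t_0,t_1)$, $\tau$ non-leaf: (1) for each $i$: if $\tau_i=l$ is a leaf, solve $\dot Y_l=F_l(t,Y_l)$, $Y_l(t_0)=Y_l^0$, let $\widehat{\mathbf{U}}_l$ have orthonormal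 columns spanning the range of $(Y_l(t_1)^\top,\mathbf{U}_l^0)$, and $\widehat{\mathbf{M}}_l=\widehat{\mathbf{U}}_l^*\mathbf{U}_l^0$; otherwise call the integrator recursively on $(\tau_i,Y_{\tau_i}^0,F_{\tau_i},t_0,t_1)$, obtaining $\widehat Y_{\tau_i}^1$ (with root connection tensor $\widehat C_{\tau_i}^1$) and $\widehat C_{\tau_i}^0$, let $\widehat{\mathbf{Q}}_{\tau_i}$ have orthonormal columns spanning the range of $(\mathrm{mat}_0(\widehat C_{\tau_i}^1)^\top,\mathrm{mat}_0(\widehat C_{\tau_i}^0)^\top)$, let $\widehat X_{\tau_i}$ be $\widehat Y_{\tau_i}^1$ with root connection tensor replaced by $\mathrm{ten}_0(\widehat{\mathbf{Q}}_{\tau_i}^\top)$, and set $\widehat{\mathbf{U}}_{\tau_i}=\mathrm{mat}_0(\widehat X_{\tau_i})^\top$, $\widehat{\mathbf{M}}_{\tau_i}=\widehat{\mathbf{U}}_{\tau_i}^*\mathbf{U}_{\tau_i}^0$. (2) Set $\widehat C_\tau^0=C_\tau^0\times_{i=1}^m\widehat{\mathbf{M}}_{\tau_i}$, solve $\dot{\widehat C}_\tau(t)=F_\tau\big(t,\widehat C_\tau(t)\times_0\mathbf{I}_{r_\tau}\times_{i=1}^m\widehat{\mathbf{U}}_{\tau_i}\big)\times_{i=1}^m\widehat{\mathbf{U}}_{\tau_i}^*$, $\widehat C_\tau(t_0)=\widehat C_\tau^0$, set $\widehat C_\tau^1=\widehat C_\tau(t_1)$, and return $\widehat Y_\tau^1=\widehat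 C_\tau^1\times_0\mathbf{I}_{r_\tau}\times_{i=1}^m\widehat{\mathbf{U}}_{\tau_i}$ and $\widehat C_\tau^0$. At the top level, $F_{\bar\tau}=F$ and $Y_{\bar\tau}^0$ is the given starting TTN. All differential equations are assumed to be solved exactly.
   Formalization: The restriction is taken with the complex conjugate of V, π†(Z)=ten_0((mat_i(Z) conj(V))^T), so that it is the adjoint of the prolongation; with V unconjugated, norm preservation fails for recursive calls with complex data. *)

(* Defs.v *)
From HB Require Import structures.
From mathcomp Require Import all_boot all_order all_algebra.
From mathcomp Require Import complex.
From mathcomp Require Import all_classical all_reals all_analysis.
From Stdlib Require List.

Set Implicit Arguments.
Unset Strict Implicit.
Unset Printing Implicit Defensive.
Import Order.TTheory GRing.Theory Num.Theory.
Import numFieldNormedType.Exports.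
Local Open Scope ring_scope.

Inductive tree := Leaf of nat | Node of seq tree.

Fixpoint leaves (t : tree) : seq nat :=
  match t with Leaf l => [:: l] | Node ts => flatten (map leaves ts) end.

Fixpoint wf_nodes (t : tree) : bool :=
  match t with Leaf _ => true | Node ts => (1 < size ts)%N && all wf_nodes ts end.

Definition tree_ok (d : nat) (t : tree) : bool :=
  [&& wf_nodes t, uniq (leaves t) & perm_eq (leaves t) (iota 1 d)].

(* Multi-indices.  For a subtree tau, an index of the mode of size n_tau is   *)
(* a nested index: Ix k (0 <= k < n_l) at a leaf l, and Tx [j_1;..;j_m] at a *)
(* node tau = (tau_1,..,tau_m), with j_i an index of tau_i.  (This is the     *)
(* row index set of U_tau, in structured rather than flattened form.)         *)

Inductive idx := Ix of nat | Tx of seq idx.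

Fixpoint cart {A : Type} (ls : seq (seq A)) : seq (seq A) :=
  match ls with
  | [::] => [:: [::]]
  | l :: ls' => [seq x :: y | x <- l, y <- cart ls']
  end.

Fixpoint idxs (n : nat -> nat) (t : tree) : seq idx :=
  match t with
  | Leaf l => map Ix (iota 0 (n l))
  | Node ts => map Tx (cart (map (idxs n) ts))
  end.

Definition cranges (rs : seq nat) : seq (seq nat) := cart (map (iota 0) rs).

Definition cart_fix {A : Type} (ls : seq (seq A)) (i : nat) (a : A) :=
  cart (set_nth [::] ls i [:: a]).

(* full tensor index set of C^{n_1 x ... x n_d} (0-based entries,
   leaf l at position l-1) *)
Definition fullidx (n : nat -> nat) (d : nat) : seq (seq nat) :=
  cart [seq iota 0 (n l) | l <- iota 1 d].

(* identification C^{n_1 x ... x n_d} = V_taubar *)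
Fixpoint nest (t : tree) (js : seq nat) : idx :=
  match t with
  | Leaf l => Ix (nth 0%N js l.-1)
  | Node ts => Tx (map (fun s => nest s js) ts)
  end.

Fixpoint leafval (t : tree) (j : idx) (l : nat) : nat :=
  match t, j with
  | Leaf l', Ix k => if l == l' then k else 0%N
  | Node ts, Tx js =>
      (fix go (ts : seq tree) (js : seq idx) : nat :=
         match ts, js with
         | s :: ts', x :: js' => (leafval s x l + go ts' js')%N
         | _, _ => 0%N
         end) ts js
  | _, _ => 0%N
  end.

Definition unnest (t : tree) (d : nat) (j : idx) : seq nat :=
  map (leafval t j) (iota 1 d).

Section TTN.
Variable R : realType.
Local Notation C := (R[i]).
Local Notation ReC := (@complex.Re R).
Local Notation ImC := (@complex.Im R).

(* An element of V_tau = C^{r_tau x n_tau_1 x ... x n_tau_m} (or C^{r_l x n_l}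
   at a leaf): entry (c, Tx [j_1..j_m]) (resp. (c, Ix k)).  *)
Definition tens := nat -> idx -> C.
(* a connection tensor in C^{r_tau x r_tau_1 x ... x r_tau_m}: entry (c, [k_1..k_m]) *)
Definition ctens := nat -> seq nat -> C.

(* a tree tensor network: TL r_l U_l (U_l : n_l x r_l) at a leaf,
   TN r_tau C_tau children at a node *)
Inductive ttn :=
| TL of nat & (idx -> nat -> C)
| TN of nat & ctens & seq ttn.

Definition rk (Y : ttn) : nat := match Y with TL r _ => r | TN r _ _ => r end.

Definition mprod (rs : seq nat) (Cc : ctens) (Us : seq (idx -> nat -> C)) : tens :=
  fun c j => match j with
  | Tx js => \sum_(ks <- cranges rs)
               Cc c ks * \prod_(p <- zip Us (zip js ks)) p.1 p.2.1 p.2.2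
  | Ix _ => 0
  end.

Fixpoint full (Y : ttn) : tens :=
  match Y with
  | TL _ U => fun c j => U j c
  | TN _ Cc ch => mprod (map rk ch) Cc (map (fun Z j c => full Z c j) ch)
  end.

Definition basis (Y : ttn) : idx -> nat -> C := fun j c => full Y c j.

Fixpoint shape_ok (t : tree) (Y : ttn) : Prop :=
  match t, Y with
  | Leaf _, TL _ _ => True
  | Node ts, TN _ _ ch =>
      size ts = size ch /\
      (fix go (ts : seq tree) (ch : seq ttn) : Prop :=
         match ts, ch with
         | s :: ts', Z :: ch' => shape_ok s Z /\ go ts' ch'
         | _, _ => True
         end) ts ch
  | _, _ => False
  end.

Definition tnormI {B : Type} (ix : seq (nat * B)) (X : nat -> B -> C) : R :=
  Num.sqrt (\sum_(p <- ix) (ReC (X p.1 p.2) ^+ 2 + ImC (X p.1 p.2) ^+ 2)).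

Definition vpairs (n : nat -> nat) (t : tree) (r : nat) : seq (nat * idx) :=
  [seq (c, j) | c <- iota 0 r, j <- idxs n t].

Definition tnorm (n : nat -> nat) (t : tree) (r : nat) (X : tens) : R :=
  tnormI (vpairs n t r) X.

Definition orthonormal_cols {B : Type} (ix : seq B) (r : nat) (U : B -> nat -> C) :=
  forall a b, (a < r)%N -> (b < r)%N ->
    \sum_(j <- ix) conjc (U j a) * U j b = (a == b)%:R.

Definition in_span {B : Type} (ix : seq B) (A : B -> nat -> C) (p : nat) (v : B -> C) :=
  exists a : nat -> C, forall j, List.In j ix -> v j = \sum_(k < p) a k * A j k.

Definition same_range {B : Type} (ix : seq B) (A : B -> nat -> C) (p : nat)
    (A' : B -> nat -> C) (q : nat) :=
  (forall k, (k < q)%N -> in_span ix A p (fun j => A' j k)) /\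
  (forall k, (k < p)%N -> in_span ix A' q (fun j => A j k)).

Definition catc {B : Type} (A : B -> nat -> C) (p : nat) (A' : B -> nat -> C) :=
  fun j k => if (k < p)%N then A j k else A' j (k - p)%N.

(* mode-i matricization of the tensor T (dims = mode sizes) has linearly
   independent rows, i.e. has rank nth dims i *)
Definition mode_full_rank (dims : seq nat) (T : seq nat -> C) (i : nat) :=
  forall a : nat -> C,
    (forall ks, List.In ks (cranges dims) ->
       \sum_(k < nth 0%N dims i) a k * T (set_nth 0%N ks i k) = 0) ->
    forall k, (k < nth 0%N dims i)%N -> a k = 0.

Definition full_ml_rank (dims : seq nat) (T : seq nat -> C) :=
  forall i, (i < size dims)%N -> mode_full_rank dims T i.

Fixpoint full_tree_rank (Y : ttn) : Prop :=
  match Y with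
  | TL _ _ => True
  | TN r Cc ch =>
      full_ml_rank (r :: map rk ch) (fun l => Cc (head 0%N l) (behead l)) /\
      (fix go (ch : seq ttn) : Prop :=
         match ch with Z :: ch' => full_tree_rank Z /\ go ch' | [::] => True end) ch
  end.

Fixpoint ttn_orth (n : nat -> nat) (t : tree) (Y : ttn) : Prop :=
  match t, Y with
  | Node ts, TN _ _ ch =>
      (fix go (ts : seq tree) (ch : seq ttn) : Prop :=
         match ts, ch with
         | s :: ts', Z :: ch' =>
             orthonormal_cols (idxs n s) (rk Z) (basis Z) /\ ttn_orth n s Z /\ go ts' ch'
         | _, _ => True
         end) ts ch
  | _, _ => True
  end.

Definition ode_sol {B : Type} (ix : seq (nat * B))
    (f : R -> (nat -> B -> C) -> (nat -> B -> C)) (y : R -> nat -> B -> C)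
    (t0 t1 : R) (y0 : nat -> B -> C) : Prop :=
  forall p, List.In p ix ->
    y t0 p.1 p.2 = y0 p.1 p.2 /\
    {within `[t0, t1], continuous (fun t => ReC (y t p.1 p.2))}%classic /\
    {within `[t0, t1], continuous (fun t => ImC (y t p.1 p.2))}%classic /\
    (forall t, t0 < t < t1 ->
       is_derive t 1 (fun s => ReC (y s p.1 p.2)) (ReC (f t (y t) p.1 p.2)) /\
       is_derive t 1 (fun s => ImC (y s p.1 p.2)) (ImC (f t (y t) p.1 p.2))).

(* QR decomposition  mat_i(C)^T = Q S^T, stored via Qt = ten_i(Q^T), a tensor  *)
(* of the same shape as C (r :: rs):                                          *)
(*   C(c,ks) = sum_l Qt(c, ks[i:=l]) S(ks_i, l),  Q orthonormal columns,      *)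
(*   S^T upper triangular.                                                     *)

Definition qr_ok (r : nat) (rs : seq nat) (C0 : ctens) (i : nat)
    (Qt : ctens) (S : nat -> nat -> C) : Prop :=
  let ri := nth 0%N rs i in
  (forall c ks, (c < r)%N -> List.In ks (cranges rs) ->
     C0 c ks = \sum_(l < ri) Qt c (set_nth 0%N ks i l) * S (nth 0%N ks i) l) /\
  (forall l l', (l < ri)%N -> (l' < ri)%N ->
     \sum_(c <- iota 0 r) \sum_(ks <- cart_fix (map (iota 0) rs) i l)
        conjc (Qt c ks) * Qt c (set_nth 0%N ks i l') = (l == l')%:R) /\
  (forall k l, (k < ri)%N -> (l < ri)%N -> (k < l)%N -> S k l = 0).

(* prolongation pi_{tau,i}(Y) = ten_i((V_i mat_0(Y))^T), written as
   ten_i(Q^T) x_0 I x_{j<>i} U_j x_i mat_0(Y)^T *)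
Definition prol (rs : seq nat) (Qt : ctens) (Us : seq (idx -> nat -> C)) (i : nat)
    (Y : tens) : tens :=
  mprod rs Qt (set_nth (fun _ _ => 0) Us i (fun j k => Y k j)).

(* V_i[(c, js_{-i}), k] *)
Definition Vmat (rs : seq nat) (Qt : ctens) (Us : seq (idx -> nat -> C)) (i : nat)
    (c : nat) (js : seq idx) (k : nat) : C :=
  \sum_(ks <- cart_fix (map (iota 0) rs) i k)
     Qt c ks * \prod_(p <- iota 0 (size rs) | p != i)
                 nth (fun _ _ => 0) Us p (nth (Ix 0) js p) (nth 0%N ks p).

(* restriction pi^dagger_{tau,i}(Z) = ten_0((mat_i(Z) conj(V_i))^T),
   the adjoint of pi_{tau,i} *)
Definition restr (n : nat -> nat) (ts : seq tree) (r : nat) (rs : seq nat)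
    (Qt : ctens) (Us : seq (idx -> nat -> C)) (i : nat) (Z : tens) : tens :=
  fun k j => \sum_(c <- iota 0 r) \sum_(js <- cart_fix (map (idxs n) ts) i j)
               Z c (Tx js) * conjc (Vmat rs Qt Us i c js k).

(* Y_{tau_i}^0 = X_{tau_i}^0 x_0 S^T (acting on the root connection tensor,
   resp. on the leaf matrix) *)
Definition mode0 (S : nat -> nat -> C) (Y : ttn) : ttn :=
  match Y with
  | TL r U => TL r (fun j c => \sum_(k < r) S k c * U j k)
  | TN r Cc ch => TN r (fun c ks => \sum_(k < r) S k c * Cc k ks) ch
  end.

Definition ttn0 : ttn := TL 0 (fun _ _ => 0).

(* top-level F_taubar: F on C^{n_1 x ... x n_d} transported to V_taubar;
   F only sees the entries of its argument inside the index range *)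
Definition mask (n : nat -> nat) (d : nat) (Y : seq nat -> C) : seq nat -> C :=
  fun js => if js \in fullidx n d then Y js else 0.

Definition Ftop (n : nat -> nat) (d : nat) (t : tree)
    (F : R -> (seq nat -> C) -> (seq nat -> C)) : R -> tens -> tens :=
  fun s Y c j =>
    if c == 0%N then F s (mask n d (fun js => Y 0%N (nest t js))) (unnest t d j) else 0.

(* The rank-augmenting TTN integrator as a relation:                           *)
(*   run n tau Y0 F t0 t1 Yhat1 Chat0 calls                                     *)
(* means that the call on (tau, Y0, F, t0, t1) (tau non-leaf) can return      *)
(* Yhat1 and Chat0 (the ODEs being solved exactly, the orthonormal bases and   *)
(* QR factors being any admissible ones), and calls lists the triples         *)
(* (sigma, Y_sigma^0, Yhat_sigma^1) of this call and of all recursive calls.   *)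

Inductive run (n : nat -> nat) :
    tree -> ttn -> (R -> tens -> tens) -> R -> R -> ttn -> ctens
    -> seq (tree * ttn * ttn) -> Prop :=
| run_node (ts : seq tree) (r : nat) (C0 : ctens) (ch : seq ttn)
    (F : R -> tens -> tens) (t0 t1 : R)
    (Qt : nat -> ctens) (S : nat -> nat -> nat -> C)
    (rh : nat -> nat) (Xh : nat -> ttn)
    (calls : nat -> seq (tree * ttn * ttn)) (Ch : R -> ctens) :
  size ch = size ts ->
  let m := size ts in
  let rs := map rk ch in
  let Us := map basis ch in
  let Fi i := fun s Y => restr n ts r rs (Qt i) Us i (F s (prol rs (Qt i) Us i Y)) in
  let Y0i i := mode0 (S i) (nth ttn0 ch i) in
  (forall i, (i < m)%N -> qr_ok r rs C0 i (Qt i) (S i)) ->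
  (forall i, (i < m)%N ->
     (exists l (y : R -> tens),
        nth (Leaf 0) ts i = Leaf l /\
        (exists U, nth ttn0 ch i = TL (nth 0%N rs i) U) /\
        ode_sol (vpairs n (Leaf l) (nth 0%N rs i)) (Fi i) y t0 t1 (full (Y0i i)) /\
        (exists Uh : idx -> nat -> C,
           Xh i = TL (rh i) Uh /\
           orthonormal_cols (idxs n (Leaf l)) (rh i) Uh /\
           same_range (idxs n (Leaf l)) Uh (rh i)
             (catc (fun j c => y t1 c j) (nth 0%N rs i) (nth (fun _ _ => 0) Us i))
             (nth 0%N rs i + nth 0%N rs i)) /\
        calls i = [::])
     \/
     (exists ts' rr (Ch1 : ctens) (chh : seq ttn) (Ch0i : ctens) (Qh : seq nat -> nat -> C),
        nth (Leaf 0) ts i = Node ts' /\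
        run n (Node ts') (Y0i i) (Fi i) t0 t1 (TN rr Ch1 chh) Ch0i (calls i) /\
        orthonormal_cols (cranges (map rk chh)) (rh i) Qh /\
        same_range (cranges (map rk chh)) Qh (rh i)
          (catc (fun ks c => Ch1 c ks) rr (fun ks c => Ch0i c ks)) (rr + rr) /\
        Xh i = TN (rh i) (fun c ks => Qh ks c) chh)) ->
  let rhs := map rh (iota 0 m) in
  let Uhs := map (fun i => basis (Xh i)) (iota 0 m) in
  let Mh i a b := \sum_(j <- idxs n (nth (Leaf 0) ts i))
                    conjc (basis (Xh i) j a) * nth (fun _ _ => 0) Us i j b in
  let Ch0 : ctens := fun c kh => \sum_(ks <- cranges rs)
             C0 c ks * \prod_(i <- iota 0 m) Mh i (nth 0%N kh i) (nth 0%N ks i) in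
  let G : R -> ctens -> ctens := fun s Cc c kh =>
       \sum_(js <- cart (map (idxs n) ts))
         F s (mprod rhs Cc Uhs) c (Tx js) *
         \prod_(i <- iota 0 m) conjc (basis (Xh i) (nth (Ix 0) js i) (nth 0%N kh i)) in
  ode_sol [seq (c, kh) | c <- iota 0 r, kh <- cranges rhs] G Ch t0 t1 Ch0 ->
  let Yh1 := TN r (Ch t1) (map Xh (iota 0 m)) in
  run n (Node ts) (TN r C0 ch) F t0 t1 Yh1 Ch0
      ((Node ts, TN r C0 ch, Yh1) :: flatten (map calls (iota 0 m))).

End TTN.

(* Main.v *)
(** Restriction is the adjoint of prolongation, so <Y, F_i(t,Y)> = <pi Y, F(t, pi Y)> and
    every reduced vector field inherits Re <Y, F(t,Y)> = 0.  At a node, the augmented bases have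
    orthonormal columns, so the norm of a tensor with these bases is the norm of its connection
    tensor, and the Galerkin equation preserves the latter.  It remains to see that the projected
    starting value is the starting value itself, i.e. that the augmented bases contain the old
    ones.  The recursive call only provides the columns of U_i S_i; full multilinear rank makes
    S_i invertible, which gives the columns of U_i and also passes full rank on to the
    connection tensor of the recursive starting value. *)

Require Import Defs.
From HB Require Import structures.
From mathcomp Require Import all_boot all_order all_algebra.
From mathcomp Require Import complex.
From mathcomp Require Import all_classical all_reals all_analysis.
From mathcomp Require Import ring.
From Stdlib Require List.
Import Order.TTheory GRing.Theory Num.Theory.
Import numFieldNormedType.Exports.
Local Open Scope ring_scope.

Set Implicit Arguments.
Unset Strict Implicit.
Unset Printing Implicit Defensive.

(** * Sums over Cartesian products and Kronecker products *)

HB.instance Definition _ := gen_eqMixin idx.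

Lemma InP (T : eqType) (x : T) (s : seq T) : reflect (List.In x s) (x \in s).
Proof.
elim: s => [|y s IH] /=; first by constructor.
rewrite inE; apply: (iffP orP).
  by case=> [/eqP->|/IH]; [left|right].
by case=> [->|/IH]; [left; rewrite eqxx|right].
Qed.

Lemma sum_ord_iota (V : nmodType) (r : nat) (f : nat -> V) :
  \sum_(k < r) f k = \sum_(k <- iota 0 r) f k.
Proof. by rewrite -(big_mkord xpredT) /index_iota subn0. Qed.

Lemma mem_cart (T : eqType) (x0 : T) (ls : seq (seq T)) (x : seq T) :
  reflect (size x = size ls /\
           forall i, (i < size ls)%N -> nth x0 x i \in nth [::] ls i)
          (x \in cart ls).
Proof.
elim: ls x => [|l ls IH] x /=.
  rewrite inE; apply: (iffP eqP) => [-> //|[/size0nil]//].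
apply: (iffP allpairsP) => [[[a y] /= [al yls ->]]|[]].
  have [sy H] := IH y yls; split=> [|[|i]] //=; first by rewrite sy.
  exact: H.
case: x => // a y /= [sy] H; exists (a, y); split=> //=; first exact: (H 0%N).
by apply/IH; split=> // i; exact: (H i.+1).
Qed.

Lemma cart_uniq (T : eqType) (ls : seq (seq T)) :
  all uniq ls -> uniq (cart ls).
Proof.
elim: ls => //= l ls IH /andP[ul /IH uls].
by apply: allpairs_uniq => // -[a x] [b y] _ _ [-> ->].
Qed.

Lemma mem_cranges (rs : seq nat) (ks : seq nat) :
  reflect (size ks = size rs /\
           forall i, (i < size rs)%N -> (nth 0%N ks i < nth 0%N rs i)%N)
          (ks \in cranges rs).
Proof.
apply: (iffP (mem_cart 0%N _ _)); rewrite size_map => -[sks H]; split=> // i ir.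
  by have := H i ir; rewrite (nth_map 0%N) // mem_iota.
by rewrite (nth_map 0%N) // mem_iota /= add0n H.
Qed.

Lemma size_cranges (rs ks : seq nat) : ks \in cranges rs -> size ks = size rs.
Proof. by case/mem_cranges. Qed.

Lemma size_mem_cart (T : eqType) (ls : seq (seq T)) x :
  x \in cart ls -> size x = size ls.
Proof.
elim: ls x => [|l ls IH] x /=; first by rewrite inE => /eqP->.
by move=> /allpairsP[[a y] /= [_ /IH <- ->]].
Qed.

Lemma cranges_uniq (rs : seq nat) : uniq (cranges rs).
Proof. by apply: cart_uniq; apply/allP => l /mapP[k _ ->]; exact: iota_uniq. Qed.

Lemma set_nth_cranges (rs ks : seq nat) i k :
  ks \in cranges rs -> (i < size rs)%N -> (k < nth 0%N rs i)%N ->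
  set_nth 0%N ks i k \in cranges rs.
Proof.
move=> /mem_cranges[sks H] ir kr; apply/mem_cranges; split.
  by rewrite size_set_nth sks; apply/maxn_idPr.
by move=> j jr; rewrite nth_set_nth /=; case: eqP => [->|_] //; exact: H.
Qed.

(** Distributivity: expanding a product of sums picks one entry from each list. Through it, sums of
    Kronecker products factor mode by mode. *)
Lemma sum_cart_prod (K : pzSemiRingType) (T : Type) (x0 : T)
    (ls : seq (seq T)) (f : nat -> T -> K) :
  \sum_(x <- cart ls) \prod_(i < size ls) f i (nth x0 x i) =
  \prod_(i < size ls) \sum_(a <- nth [::] ls i) f i a.
Proof.
elim: ls f => [|l ls IH] f /=; first by rewrite big_seq1 !big_ord0.
rewrite big_allpairs_dep big_ord_recl /= -(IH (fun i => f i.+1)) big_distrl /=.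
apply: eq_bigr => a _; rewrite big_distrr /=; apply: eq_bigr => y _.
by rewrite big_ord_recl.
Qed.

(** The sets [cart_fix ls i a] are the slices of the Cartesian product along coordinate [i];
    prolongation and restriction are summed slice by slice. *)
Lemma sum_cart_fix (V : nmodType) (T : Type) (x0 : T) (ls : seq (seq T)) i
    (g : T -> seq T -> V) : (i < size ls)%N ->
  \sum_(a <- nth [::] ls i) \sum_(x <- cart_fix ls i a) g a x =
  \sum_(x <- cart ls) g (nth x0 x i) x.
Proof.
elim: ls i g => [//|l ls IH] [|i] g /= ir.
  rewrite big_allpairs_dep; apply: eq_bigr => a _.
  by rewrite /cart_fix /= cats0 big_map.
rewrite big_allpairs_dep /=.
transitivity (\sum_(a <- nth [::] ls i) \sum_(b <- l) \sum_(y <- cart_fix ls i a) g a (b :: y)).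
  by apply: eq_bigr => a _; rewrite /cart_fix /= big_allpairs_dep.
by rewrite exchange_big; apply: eq_bigr => b _; rewrite -(IH i (fun a y => g a (b :: y))).
Qed.

Lemma prod_nth_eq (K : comPzRingType) (a b : seq nat) m : size a = m -> size b = m ->
  \prod_(i < m) (nth 0%N a i == nth 0%N b i)%:R = (a == b)%:R :> K.
Proof.
move=> sa sb; case: eqP => [->|ne]; first by rewrite big1 // => i _; rewrite eqxx.
have /existsP[i /negPf ni] : [exists i : 'I_m, nth 0%N a i != nth 0%N b i].
  apply: contrapT => /negP; rewrite negb_exists => /forallP H.
  apply: ne; apply: (@eq_from_nth _ 0%N) => [|i]; first by rewrite sa.
  by rewrite sa => im; apply/eqP; have := H (Ordinal im); rewrite negbK.
by rewrite (bigD1 i) //= ni mul0r.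
Qed.

Lemma sum_delta (V : pzRingType) (T : eqType) (s : seq T) (x : T) (f : T -> V) :
  uniq s -> x \in s -> \sum_(y <- s) (x == y)%:R * f y = f x.
Proof.
move=> us xs; rewrite (bigD1_seq x) //= eqxx mul1r big1 ?addr0 // => y.
by rewrite eq_sym => /negPf->; rewrite mul0r.
Qed.

(** The entry in row [js] and column [ks] of the Kronecker product of the matrices [A 0], ...,
    [A (m-1)]. *)
Definition kron (K : pzRingType) m (A : nat -> idx -> nat -> K)
    (js : seq idx) (ks : seq nat) : K :=
  \prod_(i < m) A i (nth (Ix 0) js i) (nth 0%N ks i).

(** * Kronecker products of complex matrices: isometry, adjoint, projection *)

Section Complex.
Variable R : realType.
Local Notation C := (R[i]).

Lemma ReD (x y : C) : complex.Re (x + y) = complex.Re x + complex.Re y.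
Proof. by case: x y => [a b] [c e]. Qed.

Lemma Re_sum (T : Type) (s : seq T) (f : T -> C) :
  complex.Re (\sum_(x <- s) f x) = \sum_(x <- s) complex.Re (f x).
Proof. by apply: (big_morph (@complex.Re R)) => // x y; exact: ReD. Qed.

Lemma Re_conjM (x y : C) :
  complex.Re (conjc x * y) =
  complex.Re x * complex.Re y + complex.Im x * complex.Im y.
Proof. by case: x y => [a b] [c e] /=; rewrite mulNr opprK. Qed.

(** The mixed-product rule: the adjoint of a Kronecker product times another one is the Kronecker
    product of the factors' products, here by distributivity. *)
Lemma kron_conjM (ls : seq (seq idx)) (A B : nat -> idx -> nat -> C) (ks ks' : seq nat) :
  \sum_(js <- cart ls) conjc (kron (size ls) A js ks) * kron (size ls) B js ks' =
  \prod_(i < size ls) \sum_(j <- nth [::] ls i)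
     conjc (A i j (nth 0%N ks i)) * B i j (nth 0%N ks' i).
Proof.
rewrite -(sum_cart_prod (Ix 0) ls
  (fun i j => conjc (A i j (nth 0%N ks i)) * B i j (nth 0%N ks' i))).
apply: eq_bigr => js _.
by rewrite /kron rmorph_prod -big_split.
Qed.

Lemma kron_orthonormal (ls : seq (seq idx)) (rs : seq nat) (A : nat -> idx -> nat -> C) ks ks' :
  size rs = size ls ->
  (forall i, (i < size ls)%N -> orthonormal_cols (nth [::] ls i) (nth 0%N rs i) (A i)) ->
  ks \in cranges rs -> ks' \in cranges rs ->
  \sum_(js <- cart ls) conjc (kron (size ls) A js ks) * kron (size ls) A js ks' = (ks == ks')%:R.
Proof.
move=> srs oA /mem_cranges[sk Hk] /mem_cranges[sk' Hk'].
rewrite kron_conjM -(@prod_nth_eq _ ks ks' (size ls)) -?srs //.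
by apply: eq_bigr => -[i /= ir] _; apply: oA; rewrite -?srs //; [exact: Hk|exact: Hk'].
Qed.

(** The Gram matrix of the Kronecker product is the identity, so inner products of coefficient
    tensors are preserved. *)
Lemma kron_isometry (ls : seq (seq idx)) (rs : seq nat) (A : nat -> idx -> nat -> C)
    (x y : seq nat -> C) :
  size rs = size ls ->
  (forall i, (i < size ls)%N -> orthonormal_cols (nth [::] ls i) (nth 0%N rs i) (A i)) ->
  \sum_(js <- cart ls)
     conjc (\sum_(ks <- cranges rs) x ks * kron (size ls) A js ks) *
     (\sum_(ks <- cranges rs) y ks * kron (size ls) A js ks) =
  \sum_(ks <- cranges rs) conjc (x ks) * y ks.
Proof.
move=> srs oA.
under eq_bigr do rewrite rmorph_sum big_distrlr /=.
rewrite exchange_big /= big_seq [RHS]big_seq; apply: eq_bigr => ks ksr.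
rewrite exchange_big /=.
rewrite -(sum_delta (fun ks' => conjc (x ks) * y ks') (cranges_uniq rs) ksr).
rewrite big_seq [RHS]big_seq; apply: eq_bigr => ks' ksr'.
rewrite -(kron_orthonormal srs oA ksr ksr') mulr_suml.
by apply: eq_bigr => js _; rewrite rmorphM mulrACA mulrC.
Qed.

Lemma kron_adjoint (ls : seq (seq idx)) (rs : seq nat) (A : nat -> idx -> nat -> C)
    (x : seq nat -> C) (z : seq idx -> C) m :
  \sum_(ks <- cranges rs) conjc (x ks) * (\sum_(js <- cart ls) z js * conjc (kron m A js ks)) =
  \sum_(js <- cart ls) conjc (\sum_(ks <- cranges rs) x ks * kron m A js ks) * z js.
Proof.
under eq_bigr do rewrite mulr_sumr.
rewrite exchange_big /=; apply: eq_bigr => js _.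
rewrite rmorph_sum mulr_suml; apply: eq_bigr => ks _.
by rewrite rmorphM -mulrA [z js * _]mulrC.
Qed.

(** For orthonormal columns, [U] times its adjoint is the orthogonal projection onto the range of
    [U], hence fixes each vector there. *)
Lemma orthonormal_proj (T : eqType) (s : seq T) r (U : T -> nat -> C) (v : T -> C) j :
  orthonormal_cols s r U -> in_span s U r v -> j \in s ->
  \sum_(k <- iota 0 r) U j k * (\sum_(i <- s) conjc (U i k) * v i) = v j.
Proof.
move=> oU [a Ha] js; rewrite (Ha j); last exact/InP.
rewrite (@sum_ord_iota _ r (fun k => a k * U j k)).
rewrite big_seq [RHS]big_seq; apply: eq_bigr => k kr; rewrite mulrC; congr (_ * _).
rewrite -[RHS](sum_delta a (iota_uniq 0 r) kr).
transitivity (\sum_(i <- s) \sum_(l <- iota 0 r) conjc (U i k) * (a l * U i l)).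
  rewrite big_seq [RHS]big_seq; apply: eq_bigr => i /InP/Ha->.
  by rewrite (@sum_ord_iota _ r (fun k => a k * U i k)) mulr_sumr.
rewrite exchange_big /= big_seq [RHS]big_seq; apply: eq_bigr => l lr.
move: kr lr; rewrite !mem_iota /= !add0n => kr lr.
rewrite -(oU k l kr lr) mulr_suml; apply: eq_bigr => i _.
by rewrite mulrA -mulrA [a l * _]mulrC mulrA.
Qed.

(** The inner product over [i] is an entry of the Kronecker product of the matrices M-hat.
    Distributivity reduces the claim to one projection in each mode, which fixes the columns of
    [U i]. *)
Lemma kron_proj (ls : seq (seq idx)) (rs rhs : seq nat) (U Uh : nat -> idx -> nat -> C)
    (x : seq nat -> C) js :
  size rs = size ls -> size rhs = size ls ->
  (forall i, (i < size ls)%N -> orthonormal_cols (nth [::] ls i) (nth 0%N rhs i) (Uh i)) ->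
  (forall i k, (i < size ls)%N -> (k < nth 0%N rs i)%N ->
     in_span (nth [::] ls i) (Uh i) (nth 0%N rhs i) (fun j => U i j k)) ->
  js \in cart ls ->
  \sum_(kh <- cranges rhs)
     (\sum_(ks <- cranges rs) x ks *
        \prod_(i < size ls)
          \sum_(j <- nth [::] ls i) conjc (Uh i j (nth 0%N kh i)) * U i j (nth 0%N ks i)) *
     kron (size ls) Uh js kh =
  \sum_(ks <- cranges rs) x ks * kron (size ls) U js ks.
Proof.
move=> srs srhs oU sU jsl; have [sj Hj] := mem_cart (Ix 0) _ _ jsl.
under eq_bigr do rewrite mulr_suml.
rewrite exchange_big /= big_seq [RHS]big_seq; apply: eq_bigr => ks /mem_cranges[sk Hk].
transitivity (x ks * \sum_(kh <- cart (map (iota 0) rhs)) \prod_(i < size (map (iota 0) rhs))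
   (Uh i (nth (Ix 0) js i) (nth 0%N kh i) *
    (\sum_(j <- nth [::] ls i) conjc (Uh i j (nth 0%N kh i)) * U i j (nth 0%N ks i)))).
  rewrite mulr_sumr; apply: eq_bigr => kh _.
  rewrite -mulrA -big_split size_map srhs; congr (_ * _).
  by apply: eq_bigr => i _; rewrite mulrC.
rewrite (sum_cart_prod 0%N _ (fun i k => Uh i (nth (Ix 0) js i) k *
    (\sum_(j <- nth [::] ls i) conjc (Uh i j k) * U i j (nth 0%N ks i)))).
congr (_ * _); rewrite size_map srhs; apply: eq_bigr => -[i /= il] _.
rewrite (nth_map 0%N) ?srhs //.
apply: (orthonormal_proj (oU i il) (sU _ _ il _)); last exact: Hj.
by apply: Hk; rewrite srs.
Qed.

End Complex.

(** * Tensors, QR factors and norms *)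

Section Tensors.
Variable R : realType.
Local Notation C := (R[i]).
Local Notation dU := (fun (_ : idx) (_ : nat) => 0 : C).

Lemma tnormI_Re (B : Type) (ix : seq (nat * B)) (X : nat -> B -> C) :
  tnormI ix X =
  Num.sqrt (complex.Re (\sum_(p <- ix) conjc (X p.1 p.2) * X p.1 p.2)).
Proof.
by rewrite /tnormI Re_sum; congr Num.sqrt; apply: eq_bigr => p _; rewrite Re_conjM !expr2.
Qed.

Lemma tnormI_ext (B : eqType) (ix : seq (nat * B)) (X Y : nat -> B -> C) :
  (forall p, p \in ix -> X p.1 p.2 = Y p.1 p.2) -> tnormI ix X = tnormI ix Y.
Proof.
move=> XY; rewrite /tnormI big_seq [in RHS]big_seq.
by congr Num.sqrt; apply: eq_bigr => p /XY ->.
Qed.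

Lemma mprod_kron (rs : seq nat) (Cc : ctens R) Us c js :
  size Us = size rs -> size js = size rs ->
  mprod rs Cc Us c (Tx js) =
  \sum_(ks <- cranges rs) Cc c ks * kron (size rs) (nth dU Us) js ks.
Proof.
move=> sU sj; rewrite /mprod big_seq [RHS]big_seq.
apply: eq_bigr => ks /size_cranges sk; congr (_ * _).
rewrite (big_nth (dU, (Ix 0, 0%N))) size_zip size2_zip ?sj ?sk // sU minnn big_mkord.
by apply: eq_bigr => i _; rewrite !nth_zip ?size2_zip ?sU ?sj ?sk.
Qed.

Lemma nth_idxs n (ts : seq tree) i :
  (i < size ts)%N -> nth [::] (map (idxs n) ts) i = idxs n (nth (Leaf 0) ts i).
Proof. exact: nth_map. Qed.

(** * Tensors at a node: isometry, prolongation and restriction *)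

Section Node.
Variables (n : nat -> nat) (ts : seq tree).
Let ls := map (idxs n) ts.

Lemma sum_idxs_node (V : nmodType) (f : idx -> V) :
  \sum_(j <- idxs n (Node ts)) f j = \sum_(js <- cart ls) f (Tx js).
Proof. by rewrite /= big_map. Qed.

Lemma mprod_isometry (rs : seq nat) (X Y : ctens R) Us c :
  size rs = size ts -> size Us = size ts ->
  (forall i, (i < size ts)%N ->
     orthonormal_cols (idxs n (nth (Leaf 0) ts i)) (nth 0%N rs i) (nth dU Us i)) ->
  forall c', \sum_(j <- idxs n (Node ts)) conjc (mprod rs X Us c j) * mprod rs Y Us c' j =
  \sum_(ks <- cranges rs) conjc (X c ks) * Y c' ks.
Proof.
move=> srs sU oU c'; rewrite sum_idxs_node.
have sls : size ls = size ts by rewrite size_map.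
rewrite -(@kron_isometry _ ls rs (nth dU Us)) ?sls // => [|i il]; last first.
  by rewrite nth_idxs //; exact: oU.
rewrite big_seq [RHS]big_seq; apply: eq_bigr => js /size_mem_cart; rewrite sls => sj.
by rewrite !mprod_kron ?srs.
Qed.

Lemma tnorm_mprod (rs : seq nat) (X : ctens R) Us r :
  size rs = size ts -> size Us = size ts ->
  (forall i, (i < size ts)%N ->
     orthonormal_cols (idxs n (nth (Leaf 0) ts i)) (nth 0%N rs i) (nth dU Us i)) ->
  tnorm n (Node ts) r (mprod rs X Us) =
  tnormI [seq (c, ks) | c <- iota 0 r, ks <- cranges rs] X.
Proof.
move=> srs sU oU; rewrite /tnorm !tnormI_Re /vpairs !big_allpairs_dep.
by congr (Num.sqrt (complex.Re _)); apply: eq_bigr => c _; exact: mprod_isometry.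
Qed.

(** [prol] is written as a mode product; splitting off the factor of mode [i] turns it into
    multiplication by the matrix V_i, the form in which it can be compared with [restr]. *)
Lemma prol_Vmat (rs : seq nat) Qt Us i (Y : tens R) c js :
  size rs = size ts -> size Us = size ts -> (i < size ts)%N -> js \in cart ls ->
  prol rs Qt Us i Y c (Tx js) =
  \sum_(k <- iota 0 (nth 0%N rs i)) Vmat rs Qt Us i c js k * Y k (nth (Ix 0) js i).
Proof.
move=> srs sU im /size_mem_cart; rewrite size_map => sj.
have ir : (i < size rs)%N by rewrite srs.
rewrite /prol mprod_kron ?srs // ?size_set_nth ?sU; last by apply/maxn_idPr.
under [RHS]eq_bigr do rewrite mulr_suml.
have -> : iota 0 (nth 0%N rs i) = nth [::] (map (iota 0) rs) i by rewrite (nth_map 0%N).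
rewrite (sum_cart_fix 0%N (fun k ks => Qt c ks *
  (\prod_(p <- iota 0 (size rs) | p != i) nth dU Us p (nth (Ix 0) js p) (nth 0%N ks p)) *
  Y k (nth (Ix 0) js i))) ?size_map //.
apply: eq_bigr => ks _; rewrite -mulrA; congr (_ * _).
have -> : iota 0 (size rs) = index_iota 0 (size ts) by rewrite /index_iota subn0 srs.
rewrite big_mkord /kron (bigD1 (Ordinal im)) //= nth_set_nth /= eqxx mulrC; congr (_ * _).
by apply: eq_bigr => p; rewrite -val_eqE /= nth_set_nth /= => /negPf ->.
Qed.

(** Both sides are the same triple sum over [k], [c] and [js], one with the conjugate of V_i
    attached to [Z], the other with V_i attached to [Y]. *)
Lemma restr_adjoint (rs : seq nat) Qt Us i r (Y Z : tens R) :
  size rs = size ts -> size Us = size ts -> (i < size ts)%N ->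
  \sum_(k <- iota 0 (nth 0%N rs i)) \sum_(j <- idxs n (nth (Leaf 0) ts i))
     conjc (Y k j) * restr n ts r rs Qt Us i Z k j =
  \sum_(c <- iota 0 r) \sum_(j <- idxs n (Node ts)) conjc (prol rs Qt Us i Y c j) * Z c j.
Proof.
move=> srs sU im.
transitivity (\sum_(k <- iota 0 (nth 0%N rs i)) \sum_(c <- iota 0 r) \sum_(js <- cart ls)
  conjc (Y k (nth (Ix 0) js i)) * (Z c (Tx js) * conjc (Vmat rs Qt Us i c js k))).
  apply: eq_bigr => k _; rewrite /restr.
  under eq_bigr do rewrite mulr_sumr.
  rewrite exchange_big /=; apply: eq_bigr => c _.
  under eq_bigr do rewrite mulr_sumr.
  rewrite -nth_idxs // (sum_cart_fix (Ix 0) (fun j js => conjc (Y k j) *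
    (Z c (Tx js) * conjc (Vmat rs Qt Us i c js k)))) // size_map //.
rewrite exchange_big /=; apply: eq_bigr => c _.
rewrite exchange_big /= big_map big_seq [RHS]big_seq.
apply: eq_bigr => js jsl; rewrite prol_Vmat // rmorph_sum mulr_suml.
by apply: eq_bigr => k _; rewrite rmorphM; ring.
Qed.

End Node.

(** * Spans, full rank and the triangular QR factors *)

Lemma in_span_sum (T : Type) (ix : seq T) (A : T -> nat -> C) p r (b : nat -> C)
    (v : nat -> T -> C) :
  (forall c, (c < r)%N -> in_span ix A p (v c)) ->
  in_span ix A p (fun j => \sum_(c <- iota 0 r) b c * v c j).
Proof.
(* Choosing coefficients needs a vector for every [c]; for [c >= r] the zero vector is taken and
   never enters the sum. *)
move=> H; have /choice[a Ha] : forall c, exists a : nat -> C, (c < r)%N ->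
    forall j, List.In j ix -> v c j = \sum_(k < p) a k * A j k.
  move=> c; case: (ltnP c r) => [/H[a Ha]|_]; first by exists a.
  by exists (fun=> 0).
exists (fun k => \sum_(c <- iota 0 r) b c * a c k) => j jix.
under [RHS]eq_bigr do rewrite mulr_suml.
rewrite exchange_big /= big_seq [RHS]big_seq; apply: eq_bigr => c.
rewrite mem_iota /= add0n => cr; rewrite (Ha c cr j jix) mulr_sumr.
by apply: eq_bigr => k _; rewrite mulrA.
Qed.

(* Mode 0 is left out: only the other modes are QR-decomposed. *)
Definition root_full_rank r (rs : seq nat) (C0 : ctens R) :=
  forall i (a : nat -> C), (i < size rs)%N ->
    (forall c ks, (c < r)%N -> ks \in cranges rs ->
       \sum_(k <- iota 0 (nth 0%N rs i)) a k * C0 c (set_nth 0%N ks i k) = 0) ->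
    forall k, (k < nth 0%N rs i)%N -> a k = 0.

Lemma full_tree_rank_node r C0 ch :
  full_tree_rank (TN r C0 ch) ->
  root_full_rank r (map (@rk R) ch) C0 /\
  forall i, (i < size ch)%N -> full_tree_rank (nth (ttn0 R) ch i).
Proof.
move=> /= [fr kids]; split=> [i a ir Ha k kr|].
  apply: (fr i.+1 ir a) => // ks /InP/mem_cranges[sks Hks].
  case: ks sks Hks => [//|c ks] /= [sks] Hks.
  rewrite (@sum_ord_iota _ _ (fun k => a k * C0 c (set_nth 0%N ks i k))).
  apply: Ha; first exact: (Hks 0%N).
  by apply/mem_cranges; split=> // j jr; exact: (Hks j.+1).
elim: ch kids {fr} => [//|Z ch IH] [fZ kids] [|i] //=; exact: IH.
Qed.

Lemma qr_invertible r (rs : seq nat) C0 i Qt S :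
  root_full_rank r rs C0 -> (i < size rs)%N -> qr_ok (R := R) r rs C0 i Qt S ->
  exists T : nat -> nat -> C, forall k b, (k < nth 0%N rs i)%N -> (b < nth 0%N rs i)%N ->
    \sum_(c <- iota 0 (nth 0%N rs i)) S k c * T c b = (k == b)%:R.
Proof.
move=> fr ir [eC _]; set q := nth 0%N rs i in eC *.
pose M := \matrix_(k < q, c < q) S k c.
have uM : M \in unitmx.
  rewrite -row_free_unit; apply/row_freeP.
  have : row_free M.
    apply/inj_row_free => v vM; apply/rowP => k0; rewrite mxE.
    (* The row vector is extended by 0 to all of [nat], the form in which [root_full_rank] takes
       coefficients. *)
    pose a k := if (insub k : option 'I_q) is Some k' then v 0 k' else 0.
    have aE (k : 'I_q) : a k = v 0 k by rewrite /a valK.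
    rewrite -aE; apply: (fr i) => // c ks cr ksr.
    transitivity (\sum_(l <- iota 0 q) Qt c (set_nth 0%N ks i l) *
                   \sum_(k <- iota 0 q) a k * S k l).
      under [RHS]eq_bigr do rewrite mulr_sumr.
      rewrite exchange_big /= big_seq [RHS]big_seq; apply: eq_bigr => k.
      rewrite mem_iota /= add0n => kq.
      rewrite eC //; last by apply/InP; exact: set_nth_cranges.
      rewrite nth_set_nth /= eqxx.
      rewrite (@sum_ord_iota _ q (fun l => Qt c (set_nth 0%N (set_nth 0%N ks i k) i l) * S k l)).
      rewrite mulr_sumr; apply: eq_bigr => l _.
      by rewrite set_set_nth eqxx; ring.
    rewrite big_seq big1 // => l; rewrite mem_iota /= add0n => lq.
    have := congr1 (fun x : 'rV_q => x 0 (Ordinal lq)) vM; rewrite !mxE => vM0.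
    rewrite -(@sum_ord_iota _ q (fun k => a k * S k l)).
    rewrite -[RHS](mulr0 (Qt c (set_nth 0%N ks i l))); congr (_ * _).
    rewrite -[RHS]vM0.
    by apply: eq_bigr => k _; rewrite mxE aE.
  by move=> /row_freeP.
pose N := invmx M.
exists (fun c b : nat => if (insub c : option 'I_q) is Some c' then
                           if (insub b : option 'I_q) is Some b' then N c' b' else 0
                         else 0).
move=> k b kq bq.
have := congr1 (fun X : 'M[C]_q => X (Ordinal kq) (Ordinal bq)) (mulmxV uM).
rewrite !mxE -val_eqE /= => <-.
rewrite -(@sum_ord_iota _ q (fun c => S k c * _)).
by apply: eq_bigr => c _; rewrite valK insubT mxE.
Qed.

Lemma full_mode0 (S : nat -> nat -> C) (Z : ttn R) c j :
  full (mode0 S Z) c j = \sum_(k <- iota 0 (rk Z)) S k c * full Z k j.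
Proof.
case: Z => [r U|r Cc ch] /=; first by rewrite (@sum_ord_iota _ r (fun k => S k c * U j k)).
case: j => [k|js]; first by rewrite big1 // => k' _; rewrite mulr0.
rewrite /=.
under eq_bigr do rewrite mulr_suml.
rewrite exchange_big /= -(@sum_ord_iota _ r (fun k => S k c * _)).
apply: eq_bigr => k _; rewrite mulr_sumr.
by apply: eq_bigr => ks _; rewrite mulrA.
Qed.

(** An invertible matrix acting on mode 0 commutes with linear combinations in mode [i], so a
    relation for the new tensor is carried back to the old one by the inverse [T]. *)
Lemma root_full_rank_mode0 r (rs : seq nat) C0 (S T : nat -> nat -> C) :
  (forall k b, (k < r)%N -> (b < r)%N ->
    \sum_(c <- iota 0 r) S k c * T c b = (k == b)%:R) ->
  root_full_rank r rs C0 ->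
  root_full_rank r rs (fun c ks => \sum_(k < r) S k c * C0 k ks).
Proof.
move=> ST fr i a ir Ha; apply: fr => // b ks br ksr.
pose f c' := \sum_(k <- iota 0 (nth 0%N rs i)) a k * C0 c' (set_nth 0%N ks i k).
rewrite -[LHS]/(f b) -(@sum_delta _ _ (iota 0 r) b f) ?iota_uniq ?mem_iota //.
(* The Kronecker delta is expanded as [S] times [T]; each inner sum is then a relation of the
   transformed tensor, which vanishes by [Ha]. *)
transitivity (\sum_(c <- iota 0 r) T c b * \sum_(c' <- iota 0 r) S c' c * f c').
  under [RHS]eq_bigr do rewrite mulr_sumr.
  rewrite exchange_big /= big_seq [RHS]big_seq; apply: eq_bigr => c'.
  rewrite mem_iota /= add0n => c'r; rewrite eq_sym -ST // mulr_suml.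
  by apply: eq_bigr => c _; ring.
rewrite big_seq big1 // => c; rewrite mem_iota /= add0n => cr.
rewrite -[RHS](mulr0 (T c b)); congr (_ * _).
rewrite -[RHS](Ha c ks cr ksr).
under eq_bigr do rewrite mulr_sumr.
rewrite exchange_big /=; apply: eq_bigr => k _.
rewrite (@sum_ord_iota _ r (fun k' => S k' c * C0 k' (set_nth 0%N ks i k))) mulr_sumr.
by apply: eq_bigr => c' _; ring.
Qed.

(** The columns of U are combinations, with coefficients from the inverse [V], of the columns of
    US. *)
Lemma in_span_mode0 (ix : seq idx) (A : idx -> nat -> C) p (Z : ttn R)
    (S V : nat -> nat -> C) :
  (forall k b, (k < rk Z)%N -> (b < rk Z)%N ->
    \sum_(c <- iota 0 (rk Z)) S k c * V c b = (k == b)%:R) ->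
  (forall c, (c < rk Z)%N -> in_span ix A p (full (mode0 S Z) c)) ->
  forall b, (b < rk Z)%N -> in_span ix A p (full Z b).
Proof.
move=> SV H b br; have [a Ha] := in_span_sum (fun c => V c b) H.
exists a => j /Ha <-.
rewrite -(@sum_delta _ _ (iota 0 (rk Z)) b (fun k => full Z k j)) ?iota_uniq ?mem_iota //.
under [RHS]eq_bigr do rewrite full_mode0 mulr_sumr.
rewrite exchange_big /= big_seq [RHS]big_seq; apply: eq_bigr => k.
rewrite mem_iota /= add0n => kr; rewrite eq_sym -SV // mulr_suml.
by apply: eq_bigr => c _; ring.
Qed.

(** The squared norm [e] is continuous on the closed interval and has derivative twice the real part
    of the inner product of [y] and [f] inside it; this is zero, so the mean value theorem equates
    the end values. *)
Lemma ode_norm (B : Type) (ix : seq (nat * B)) f (y : R -> nat -> B -> C) (t0 t1 : R) y0 :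
  t0 < t1 -> ode_sol ix f y t0 t1 y0 ->
  (forall t, t0 < t < t1 ->
     complex.Re (\sum_(p <- ix) conjc (y t p.1 p.2) * f t (y t) p.1 p.2) = 0) ->
  tnormI ix (y t1) = tnormI ix y0.
Proof.
move=> t01 sol H0.
pose e (s : seq (nat * B)) (t : R) : R :=
  \sum_(p <- s) (complex.Re (y t p.1 p.2) ^+ 2 + complex.Im (y t p.1 p.2) ^+ 2).
pose de (s : seq (nat * B)) (t : R) : R :=
  \sum_(p <- s) 2 * (complex.Re (y t p.1 p.2) * complex.Re (f t (y t) p.1 p.2) +
                      complex.Im (y t p.1 p.2) * complex.Im (f t (y t) p.1 p.2)).
have -> : tnormI ix y0 = Num.sqrt (e ix t0).
  rewrite /tnormI; congr Num.sqrt; rewrite /e.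
  have {H0} : forall p, List.In p ix -> y t0 p.1 p.2 = y0 p.1 p.2 by move=> p /sol[].
  elim: ix {sol} => [|p s IH] H; first by rewrite !big_nil.
  by rewrite !big_cons H ?IH //=; [move=> q qi; apply: H; right | left].
rewrite /tnormI; congr Num.sqrt; rewrite -/(e ix t1).
(* Continuity and differentiability of the finite sum follow by induction on the index list, one
   entry at a time. *)
have [ce dE] : {within `[t0, t1], continuous (e ix)}%classic /\
    forall t, t \in `]t0, t1[ -> is_derive t 1 (e ix) (de ix t).
  elim: ix {H0} sol => [|p s IH] sol.
    have -> : e [::] = fun=> 0 by apply/funext => t; rewrite /e big_nil.
    split=> [|t _]; first by apply: continuous_subspaceT => x; exact: cvg_cst.
    by rewrite /de big_nil; exact: is_derive_cst.
  have [cI dI] := IH (fun q qi => sol q (or_intror qi)).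
  have [_ [cR [cJ dp]]] := sol p (or_introl (erefl p)).
  have -> : e (p :: s) =
    (fun t => complex.Re (y t p.1 p.2)) * (fun t => complex.Re (y t p.1 p.2)) +
    (fun t => complex.Im (y t p.1 p.2)) * (fun t => complex.Im (y t p.1 p.2)) + e s.
    by apply/funext => t; rewrite /e big_cons !expr2.
  split=> [|t tI].
    apply: within_continuousD => //; apply: within_continuousD => x.
      exact: (cvgM (cR x) (cR x)).
    exact: (cvgM (cJ x) (cJ x)).
  have /dp[dR dJ] : t0 < t < t1 by move: tI; rewrite in_itv.
  have := is_deriveD (is_deriveD (is_deriveM dR dR) (is_deriveM dJ dJ)) (dI t tI).
  move=> d; apply: is_derive_eq d _; rewrite /de big_cons; congr (_ + _).
  by rewrite /GRing.scale /=; ring.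
have [c cI] := MVT t01 dE ce.
have -> : de ix c = 0; last by rewrite mul0r => /eqP; rewrite subr_eq0 => /eqP.
have c01 : t0 < c < t1 by move: cI; rewrite in_itv.
rewrite /de -mulr_sumr -[RHS](mulr0 2); congr (_ * _).
rewrite -[RHS](H0 c c01) Re_sum.
by apply: eq_bigr => p _; rewrite Re_conjM.
Qed.

End Tensors.

(** * The integrator *)

(** Subtrees are nested inside a list, so the induction hypothesis for each child is built by an
    inner induction on that list. *)
Lemma tree_nested_ind (P : Defs.tree -> Prop) :
  (forall l, P (Leaf l)) ->
  (forall ts, (forall i, (i < size ts)%N -> P (nth (Leaf 0) ts i)) -> P (Node ts)) ->
  forall t, P t.
Proof.
move=> HL HN; fix rec 1 => -[l|ts]; first exact: HL.
apply: HN; elim: ts => [i _|t ts IH [|i]].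
- rewrite nth_nil; exact: HL.
- move=> _; exact: rec.
- exact: IH.
Qed.

Lemma In_flatten_map (A B : Type) (f : A -> seq B) s x :
  List.In x (flatten (map f s)) -> exists2 a, List.In a s & List.In x (f a).
Proof.
elim: s => [//|a s IH] /= /(@List.in_app_or B (f a) (flatten (map f s)) x)[xa|/IH[b bs xb]].
  by exists a => //; left.
by exists b => //; right.
Qed.

Section Integrator.
Variable R : realType.
Local Notation C := (R[i]).
Local Notation dU := (fun (_ : idx) (_ : nat) => 0 : C).

(** The energy identity at a subtree. [Y] is any function, with arbitrary values off the index
    range, so the identity applies directly to prolonged tensors. *)
Definition conservative n t r (F : R -> tens R -> tens R) t0 t1 :=
  forall s, t0 <= s <= t1 -> forall Y : tens R,
    complex.Re (\sum_(c <- iota 0 r) \sum_(j <- idxs n t) conjc (Y c j) * F s Y c j) = 0.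

Lemma conservative_restr n ts r (rs : seq nat) Qt Us i F t0 t1 :
  size rs = size ts -> size Us = size ts -> (i < size ts)%N ->
  conservative n (Node ts) r F t0 t1 ->
  conservative n (nth (Leaf 0) ts i) (nth 0%N rs i)
    (fun s Y => restr n ts r rs Qt Us i (F s (prol rs Qt Us i Y))) t0 t1.
Proof. by move=> srs sU im cF s s01 Y; rewrite restr_adjoint // cF. Qed.

Lemma mprod_span (rs : seq nat) (X : ctens R) (Q : seq nat -> nat -> C) p (a : nat -> C) Us c j :
  (forall ks, List.In ks (cranges rs) -> X c ks = \sum_(b < p) a b * Q ks b) ->
  mprod rs X Us c j = \sum_(b < p) a b * mprod rs (fun b ks => Q ks b) Us b j.
Proof.
move=> XE; case: j => [k|js] /=; first by rewrite big1 // => b _; rewrite mulr0.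
under [RHS]eq_bigr do rewrite mulr_sumr.
rewrite exchange_big /= big_seq [RHS]big_seq; apply: eq_bigr => ks /InP/XE ->.
by rewrite mulr_suml; apply: eq_bigr => b _; rewrite mulrA.
Qed.

Lemma catc_r (B : Type) (A A' : B -> nat -> C) p k :
  (fun j => catc A p A' j (p + k)%N) = A'^~ k.
Proof. by apply/funext => j; rewrite /catc ltnNge leq_addr /= addKn. Qed.

(** * The Galerkin step of one call, given augmented bases at the children *)

Section Node.
Variables (n : nat -> nat) (ts : seq Defs.tree) (r : nat) (C0 : ctens R) (ch : seq (ttn R)).
Variables (F : R -> tens R -> tens R) (t0 t1 : R).
Variables (rh : nat -> nat) (Xh : nat -> ttn R).
Let m := size ts.
Let rs := map (@rk R) ch.
Let Us := map (@Defs.basis R) ch.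
Let rhs := map rh (iota 0 m).
Let Uhs := map (fun i => Defs.basis (Xh i)) (iota 0 m).

Hypothesis sch : size ch = size ts.
Hypothesis cF : conservative n (Node ts) r F t0 t1.
Hypothesis oX : forall i, (i < m)%N ->
  orthonormal_cols (idxs n (nth (Leaf 0) ts i)) (rh i) (Defs.basis (Xh i)).
Hypothesis sX : forall i b, (i < m)%N -> (b < nth 0%N rs i)%N ->
  in_span (idxs n (nth (Leaf 0) ts i)) (Defs.basis (Xh i)) (rh i) (fun j => nth dU Us i j b).

(** [Ch0] and [G] restate the starting value and the projected vector field of [run_node], with the
    entries of M-hat written out. *)
Let Ch0 : ctens R := fun c kh => \sum_(ks <- cranges rs)
  C0 c ks * \prod_(i <- iota 0 m) \sum_(j <- idxs n (nth (Leaf 0) ts i))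
    conjc (Defs.basis (Xh i) j (nth 0%N kh i)) * nth dU Us i j (nth 0%N ks i).

Let G : R -> ctens R -> ctens R := fun s Cc c kh =>
  \sum_(js <- cart (map (idxs n) ts))
    F s (mprod rhs Cc Uhs) c (Tx js) *
    \prod_(i <- iota 0 m) conjc (Defs.basis (Xh i) (nth (Ix 0) js i) (nth 0%N kh i)).

Let nth_rhs i : (i < m)%N -> nth 0%N rhs i = rh i.
Proof. by move=> im; rewrite (nth_map 0%N) ?size_iota // nth_iota. Qed.

Let nth_Uhs i : (i < m)%N -> nth dU Uhs i = Defs.basis (Xh i).
Proof. by move=> im; rewrite (nth_map 0%N) ?size_iota // nth_iota. Qed.

Let prod_iota (f : nat -> C) : \prod_(i <- iota 0 m) f i = \prod_(i < m) f i.
Proof. by rewrite -(big_mkord xpredT) /index_iota subn0. Qed.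

(* The augmented bases contain the old ones, so projecting onto them loses nothing. *)
Lemma mprod_Ch0 c j : j \in idxs n (Node ts) ->
  mprod rhs Ch0 Uhs c j = mprod rs C0 Us c j.
Proof.
case/mapP => js jsl ->; have sj := size_mem_cart jsl; rewrite size_map in sj.
have sls : size (map (idxs n) ts) = m by rewrite size_map.
have srs : size rs = size (map (idxs n) ts) by rewrite sls size_map.
have srhs : size rhs = size (map (idxs n) ts) by rewrite sls size_map size_iota.
rewrite !mprod_kron ?size_map ?size_iota ?sch // -/m -sls.
rewrite -(@kron_proj _ (map (idxs n) ts) rs rhs (nth dU Us) (nth dU Uhs) (C0 c)) //; first last.
- by rewrite sls => i b im br; rewrite nth_idxs // nth_rhs // nth_Uhs //; exact: sX.
- by rewrite sls => i im; rewrite nth_idxs // nth_rhs // nth_Uhs //; exact: oX.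
apply: eq_bigr => kh _; congr (_ * _); apply: eq_bigr => ks _; congr (_ * _).
rewrite prod_iota sls; apply: eq_bigr => -[i /= im] _.
by rewrite nth_idxs // nth_Uhs.
Qed.

Lemma galerkin_norm (Ch : R -> ctens R) : t0 < t1 ->
  ode_sol [seq (c, kh) | c <- iota 0 r, kh <- cranges rhs] G Ch t0 t1 Ch0 ->
  tnorm n (Node ts) r (mprod rhs (Ch t1) Uhs) = tnorm n (Node ts) r (mprod rs C0 Us).
Proof.
move=> t01 sol.
have iso X : tnorm n (Node ts) r (mprod rhs X Uhs) =
    tnormI [seq (c, ks) | c <- iota 0 r, ks <- cranges rhs] X.
  apply: tnorm_mprod; rewrite ?size_map ?size_iota // => i im.
  by rewrite nth_rhs // nth_Uhs //; exact: oX.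
(* The projected starting value is compared first with the original one, then with the solution at
   [t1] through the connection tensors alone. *)
transitivity (tnorm n (Node ts) r (mprod rhs Ch0 Uhs)); last first.
  by apply: tnormI_ext => -[c j] /allpairsP[[c' j'] [_ jI [-> ->]]]; exact: mprod_Ch0.
rewrite !iso; apply: (ode_norm t01 sol) => t /andP[/ltW t0t /ltW tt1].
have tI : t0 <= t <= t1 by rewrite t0t.
rewrite -[RHS](cF tI (mprod rhs (Ch t) Uhs)) big_allpairs_dep; congr complex.Re.
apply: eq_bigr => c _; rewrite sum_idxs_node.
(* [G] applies the adjoint of the Kronecker product of the new bases, so it can be moved onto
   [Ch t], which yields the full tensor paired with [F]. *)
transitivity (\sum_(ks <- cranges rhs) conjc (Ch t c ks) * \sum_(js <- cart (map (idxs n) ts))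
   F t (mprod rhs (Ch t) Uhs) c (Tx js) * conjc (kron m (nth dU Uhs) js ks)).
  apply: eq_bigr => ks _; congr (_ * _); apply: eq_bigr => js _; congr (_ * _).
  rewrite rmorph_prod prod_iota; apply: eq_bigr => -[i /= im] _.
  by rewrite nth_Uhs.
rewrite (kron_adjoint _ _ _ (Ch t c)) big_seq [RHS]big_seq; apply: eq_bigr => js /size_mem_cart.
by rewrite size_map => sj; rewrite mprod_kron ?size_map ?size_iota.
Qed.

End Node.

(** Besides the norms, the parent call needs that the children's new bases are orthonormal and that
    [Ch0] with these bases reproduces the starting TTN. Full rank is stated separately for root and
    children because [mode0] changes only the root of a recursive starting TTN. *)
Lemma run_norm n t (Y0 : ttn R) F t0 t1 Yh1 Ch0 calls :
  t0 < t1 -> run n t Y0 F t0 t1 Yh1 Ch0 calls ->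
  conservative n t (rk Y0) F t0 t1 ->
  (forall r C0 ch, Y0 = TN r C0 ch ->
     root_full_rank r (map (@rk R) ch) C0 /\
     forall i, (i < size ch)%N -> full_tree_rank (nth (ttn0 R) ch i)) ->
  exists ts C1 chh, [/\ t = Node ts, Yh1 = TN (rk Y0) C1 chh & [/\ size chh = size ts,
    (forall i, (i < size ts)%N -> orthonormal_cols (idxs n (nth (Leaf 0) ts i))
        (rk (nth (ttn0 R) chh i)) (Defs.basis (nth (ttn0 R) chh i))),
    (forall c j, j \in idxs n t ->
        mprod (map (@rk R) chh) Ch0 (map (@Defs.basis R) chh) c j = full Y0 c j) &
    forall tau Y Yh, List.In (tau, Y, Yh) calls ->
        tnorm n tau (rk Yh) (full Yh) = tnorm n tau (rk Y) (full Y)]].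
Proof.
elim/tree_nested_ind: t Y0 F Yh1 Ch0 calls => [l|ts IH] Y0 F Yh1 Ch0 calls t01 Hrun.
  by inversion Hrun.
move Et: (Node ts) Hrun => t Hrun.
case: t Y0 F t0 t1 Yh1 Ch0 calls / Hrun Et t01 IH => ts' r C0 ch F t0 t1 Qt S rh Xh calls Ch
  sch m rs Us Fi Y0i Hqr Hi rhs Uhs Mh Ch0 G sol Yh1 [ets] t01 IH cF fr.
subst ts'.
have [fr0 frk] := fr r C0 ch erefl.
have nrs i : (i < m)%N -> nth 0%N rs i = rk (nth (ttn0 R) ch i).
  by move=> im; rewrite (nth_map (ttn0 R)) // sch.
have nUs i : (i < m)%N -> nth dU Us i = Defs.basis (nth (ttn0 R) ch i).
  by move=> im; rewrite (nth_map (ttn0 R)) // sch.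
have srs : size rs = size ts by rewrite size_map.
have sUs : size Us = size ts by rewrite size_map.
have K i : (i < m)%N ->
    [/\ rk (Xh i) = rh i,
        orthonormal_cols (idxs n (nth (Leaf 0) ts i)) (rh i) (Defs.basis (Xh i)),
        (forall b, (b < nth 0%N rs i)%N ->
           in_span (idxs n (nth (Leaf 0) ts i)) (Defs.basis (Xh i)) (rh i)
             (fun j => nth dU Us i j b)) &
        forall tau Y Yh, List.In (tau, Y, Yh) (calls i) ->
          tnorm n tau (rk Yh) (full Yh) = tnorm n tau (rk Y) (full Y)].
  move=> im; case: (Hi i im).
    case=> l [y [tsi [_ [_ [[Uh [-> [oU [sU _]]]] ->]]]]].
    rewrite tsi; split=> // b br.
    (* At a leaf, the old basis is the second block of the matrix whose range is spanned. *)
    by rewrite -(catc_r (fun j c => y t1 c j) _ (nth 0%N rs i)); apply: sU; rewrite ltn_add2l.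
  move=> [ts' [rr [Ch1 [chh [Ch0i [Qh [tsi [Hrun [oQ [[sQ _] XhE]]]]]]]]]].
  have ir : (i < size rs)%N by rewrite srs.
  have [T ST] := qr_invertible fr0 ir (Hqr i im).
  have rk0 : rk (Y0i i) = nth 0%N rs i by rewrite /Y0i nrs //; case: (nth (ttn0 R) ch i).
  have cFi := conservative_restr (Qt i) srs sUs im cF.
  rewrite -rk0 in cFi; rewrite -tsi in Hrun.
  have [|ts'' [C1 [chh' [ets [err _ echh] [schh oc pc Hc]]]]] :=
      IH i im _ _ _ _ _ t01 Hrun cFi.
    (* Full rank passes to the recursive starting TTN: its root tensor changes by the invertible
       [S i], its children not at all. *)
    move=> r' C' ch'; rewrite /Y0i; have := frk i; rewrite sch => /(_ im).
    move: rk0; rewrite /Y0i nrs // in ST *.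
    case: (nth (ttn0 R) ch i) ST => // r'' C'' ch'' ST _ /full_tree_rank_node[fr'' frk''].
    by move=> [<- <- <-]; split=> //; exact: root_full_rank_mode0 ST fr''.
  subst chh' rr.
  (* The child's orthonormal bases act isometrically on connection tensors, so the columns of [Qh]
     stay orthonormal. *)
  have oX : orthonormal_cols (idxs n (nth (Leaf 0) ts i)) (rh i) (Defs.basis (Xh i)).
    rewrite ets => a b ar br; rewrite -(oQ a b ar br) XhE.
    apply: (@mprod_isometry _ n ts''); rewrite ?size_map // => k kts.
    by rewrite !(nth_map (ttn0 R)) ?schh //; exact: oc.
  split=> //; first by rewrite XhE.
  (* Since [T] inverts [S i], it suffices to span the columns of U_i S_i, which belong to the
     recursive starting TTN. *)
  rewrite nUs // nrs //; apply: (@in_span_mode0 _ _ _ _ _ (S i) T); rewrite -nrs //.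
  move=> c cr; rewrite -rk0 in cr.
  have [a Ha] : in_span (cranges (map (@rk R) chh)) Qh (rh i) (Ch0i c).
    (* The offset by the rank selects the second block, the columns coming from [Ch0i]. *)
    have := @sQ (rk (Y0i i) + c)%N; rewrite ltn_add2l => /(_ cr).
    by rewrite (catc_r (fun ks c => Ch1 c ks)).
  (* By [pc], [Ch0i] assembled with [chh] is the recursive starting TTN; assembling is linear, so
     the same coefficients work. *)
  exists a => j /InP ji; rewrite -/(Y0i i) -pc // XhE.
  by rewrite (mprod_span _ _ Ha).
have oX i : (i < m)%N -> _ := fun im => let: And4 _ h _ _ := K i im in h.
have sX i b (im : (i < m)%N) : _ := let: And4 _ _ h _ := K i im in h b.
have eUhs : map (@Defs.basis R) (map Xh (iota 0 m)) = Uhs by rewrite -map_comp.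
have erhs : map (@rk R) (map Xh (iota 0 m)) = rhs.
  rewrite -map_comp; apply/eq_in_map => i; rewrite mem_iota /= add0n => im.
  by case: (K i im).
exists ts, (Ch t1), (map Xh (iota 0 m)); split=> //; split.
- by rewrite size_map size_iota.
- move=> i im; rewrite (nth_map 0%N) ?size_iota // nth_iota // add0n.
  by case: (K i im) => ->.
- by move=> c j ji; rewrite erhs eUhs; apply: mprod_Ch0.
- move=> tau Y Yh [[<- <- <-]|Hin].
    rewrite -[full Yh1]/(mprod _ _ (map (@Defs.basis R) _)) erhs eUhs.
    exact: (galerkin_norm sch cF oX sX t01 sol).
  have [i /InP] := @In_flatten_map _ _ calls (iota 0 m) _ Hin.
  by rewrite mem_iota /= add0n => im; case: (K i im) => _ _ _; apply.
Qed.

End Integrator.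

(** * Identification of the top-level tensor space *)

Lemma flatten_disjoint (T : eqType) (ls : seq (seq T)) i k x : uniq (flatten ls) ->
  x \in nth [::] ls i -> x \in nth [::] ls k -> i = k.
Proof.
elim: ls i k => [|l ls IH] i k /=; first by rewrite nth_nil.
rewrite cat_uniq => /and3P[_ /hasPn D /IH {}IH].
have memf q : x \in nth [::] ls q -> x \in l -> False.
  move=> xq xl; have /D : x \in flatten ls; last by rewrite /= xl.
  apply/flattenP; exists (nth [::] ls q) => //; apply: mem_nth.
  by case: ltnP xq => // /(nth_default [::]) ->.
case: i k => [|i] [|k] //= xi xk; last by rewrite (IH i k).
- by case: (memf k).
- by case: (memf i).
Qed.

Lemma mem_leaves_nth ts l :
  reflect (exists2 i, (i < size ts)%N & l \in leaves (nth (Leaf 0) ts i))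
          (l \in leaves (Node ts)).
Proof.
rewrite -[leaves _]/(flatten (map leaves ts)).
apply: (iffP flattenP) => [[s sl li]|[i im li]].
  have [i im es] := nthP ([::] : seq nat) sl; move: im es.
  rewrite size_map => im; rewrite (nth_map (Leaf 0)) // => es.
  by exists i; rewrite ?es.
exists (leaves (nth (Leaf 0) ts i)) => //; apply/(nthP ([::] : seq nat)).
by exists i; rewrite ?size_map // (nth_map (Leaf 0)).
Qed.

Lemma uniq_leaves_nth ts i :
  uniq (leaves (Node ts)) -> (i < size ts)%N -> uniq (leaves (nth (Leaf 0) ts i)).
Proof.
elim: ts i => [//|t ts IH] i /=; rewrite cat_uniq => /and3P[ut _ uts].
by case: i => [|i] //=; exact: IH.
Qed.

Lemma leafval_node ts js l : size js = size ts ->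
  leafval (Node ts) (Tx js) l =
  (\sum_(i < size ts) leafval (nth (Leaf 0) ts i) (nth (Ix 0) js i) l)%N.
Proof.
elim: ts js => [|t ts IH] [|j js] //=; first by rewrite big_ord0.
by case=> /IH {}IH; rewrite big_ord_recl /= -IH.
Qed.

Lemma leafval_notin n t j l : j \in idxs n t -> l \notin leaves t -> leafval t j l = 0%N.
Proof.
elim/tree_nested_ind: t j => [l'|ts IH] j.
  by move=> /mapP[k _ ->]; rewrite /= inE => /negPf ->.
case/mapP => js jsl -> lts; have [sj Hj] := mem_cart (Ix 0) _ _ jsl.
rewrite size_map in sj Hj; rewrite leafval_node // big1 // => -[i /= im] _.
apply: IH => //; first by rewrite -nth_idxs //; exact: Hj.
by apply: contra lts => li; apply/mem_leaves_nth; exists i.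
Qed.

(** A subtree without the leaf [l] contributes the default value 0, and disjointness of the leaf
    sets leaves a single nonzero candidate in the sum. *)
Lemma leafval_child n ts js i l : uniq (leaves (Node ts)) -> (i < size ts)%N ->
  js \in cart (map (idxs n) ts) -> l \in leaves (nth (Leaf 0) ts i) ->
  leafval (Node ts) (Tx js) l = leafval (nth (Leaf 0) ts i) (nth (Ix 0) js i) l.
Proof.
move=> us im jsl li; have [sj Hj] := mem_cart (Ix 0) _ _ jsl.
rewrite size_map in sj Hj.
rewrite leafval_node // (bigD1 (Ordinal im)) //= big1 ?addn0 // => -[k /= km] ki.
apply: (@leafval_notin n); first by rewrite -nth_idxs //; exact: Hj.
apply: contra ki => lk; apply/eqP/val_inj => /=.
by apply: (@flatten_disjoint _ (map leaves ts) k i l) => //; rewrite (nth_map (Leaf 0)).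
Qed.

Lemma leafval_lt n t j l : uniq (leaves t) -> j \in idxs n t -> l \in leaves t ->
  (leafval t j l < n l)%N.
Proof.
elim/tree_nested_ind: t j => [l'|ts IH] j us.
  by move=> /mapP[k + ->]; rewrite mem_iota /= inE => kn /eqP->; rewrite eqxx.
case/mapP => js jsl -> /mem_leaves_nth[i im li].
have [_ Hj] := mem_cart (Ix 0) _ _ jsl; rewrite size_map in Hj.
rewrite (leafval_child us im jsl li); apply: IH => //.
  exact: uniq_leaves_nth.
by rewrite -nth_idxs //; exact: Hj.
Qed.

Lemma nest_mem_idxs n t js : (forall l, l \in leaves t -> (nth 0%N js l.-1 < n l)%N) ->
  nest t js \in idxs n t.
Proof.
elim/tree_nested_ind: t => [l|ts IH] H.
  by apply: map_f; rewrite mem_iota /= H // inE.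
apply: map_f; apply/(mem_cart (Ix 0)); rewrite !size_map; split=> // i im.
rewrite nth_idxs // (nth_map (Leaf 0)) //; apply: IH => // l li.
by apply: H; apply/mem_leaves_nth; exists i.
Qed.

Lemma leafval_nest t js l : uniq (leaves t) -> l \in leaves t ->
  leafval t (nest t js) l = nth 0%N js l.-1.
Proof.
(* Dimensions just large enough for [js] put [nest t js] in range, so [leafval_child] applies
   although the claim has no bound on [js]. *)
pose n (l : nat) := (nth 0%N js l.-1).+1.
elim/tree_nested_ind: t => [l'|ts IH] us; first by rewrite /= inE => /eqP->; rewrite eqxx.
move=> /mem_leaves_nth[i im li].
have /mapP[js' jsl [ejs]] : nest (Node ts) js \in idxs n (Node ts) by exact: nest_mem_idxs.
rewrite -[nest _ _]/(Tx (map (nest^~ js) ts)) ejs (leafval_child us im jsl li) -ejs.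
by rewrite (nth_map (Leaf 0)) // IH // uniq_leaves_nth.
Qed.

Lemma nest_leafval n t j js : uniq (leaves t) -> j \in idxs n t ->
  (forall l, l \in leaves t -> nth 0%N js l.-1 = leafval t j l) -> nest t js = j.
Proof.
elim/tree_nested_ind: t j => [l|ts IH] j us.
  by move=> /mapP[k _ ->] H; rewrite /= H ?inE //= eqxx.
case/mapP => js' jsl -> H; congr Tx.
have [sj Hj] := mem_cart (Ix 0) _ _ jsl; rewrite size_map in sj Hj.
apply: (@eq_from_nth _ (Ix 0)) => [|i]; first by rewrite size_map.
rewrite size_map => im; rewrite (nth_map (Leaf 0)) //; apply: IH => //.
- exact: uniq_leaves_nth.
- by rewrite -nth_idxs //; exact: Hj.
- move=> l li; rewrite -(leafval_child us im jsl li); apply: H.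
  by apply/mem_leaves_nth; exists i.
Qed.

Lemma idxs_uniq n t : uniq (idxs n t).
Proof.
elim/tree_nested_ind: t => [l|ts IH].
  by rewrite map_inj_uniq ?iota_uniq // => a b [].
rewrite /= map_inj_uniq => [|a b []//]; apply: cart_uniq.
apply/(all_nthP [::]) => i; rewrite size_map => im.
by rewrite nth_idxs //; exact: IH.
Qed.

Lemma mem_fullidx n d js :
  reflect (size js = d /\ forall i, (i < d)%N -> (nth 0%N js i < n i.+1)%N)
          (js \in fullidx n d).
Proof.
apply: (iffP (mem_cart 0%N _ _)); rewrite size_map size_iota => -[sj H]; split=> // i id.
  by have := H i id; rewrite (nth_map 0%N) ?size_iota // nth_iota // mem_iota.
by rewrite (nth_map 0%N) ?size_iota // nth_iota // mem_iota /= add0n add1n H.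
Qed.

(** * The bijection between flat and nested indices at the root *)

Section Identification.
Variables (n : nat -> nat) (d : nat) (t : Defs.tree).
Hypothesis ok : tree_ok d t.

Let us : uniq (leaves t). Proof. by case/and3P: ok. Qed.

Let mem_leaves l : (l \in leaves t) = (0 < l <= d)%N.
Proof. by case/and3P: ok => _ _ /perm_mem ->; rewrite mem_iota add1n ltnS. Qed.

Let nth_unnest j i : (i < d)%N -> nth 0%N (unnest t d j) i = leafval t j i.+1.
Proof. by move=> id; rewrite (nth_map 0%N) ?size_iota // nth_iota // add1n. Qed.

Lemma unnest_mem_fullidx j : j \in idxs n t -> unnest t d j \in fullidx n d.
Proof.
move=> jt; apply/mem_fullidx; rewrite size_map size_iota; split=> // i id.
by rewrite nth_unnest //; apply: leafval_lt => //; rewrite mem_leaves.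
Qed.

Lemma unnestK j : j \in idxs n t -> nest t (unnest t d j) = j.
Proof.
move=> jt; apply: (nest_leafval us jt) => l; rewrite mem_leaves => /andP[l0 ld].
(* Leaf [l] sits at position [l.-1]; leaves are numbered from 1, so the shift is undone. *)
by rewrite nth_unnest prednK.
Qed.

Lemma nestK js : js \in fullidx n d -> unnest t d (nest t js) = js.
Proof.
move=> /mem_fullidx[sj _]; apply: (@eq_from_nth _ 0%N) => [|i].
  by rewrite size_map size_iota.
rewrite size_map size_iota => id; rewrite nth_unnest // leafval_nest //.
by rewrite mem_leaves.
Qed.

(** [nest] and [unnest] are mutually inverse on the two duplicate-free index lists; hence inner
    products agree in both forms. *)
Lemma perm_unnest : perm_eq (map (unnest t d) (idxs n t)) (fullidx n d).
Proof.
apply: uniq_perm.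
- rewrite map_inj_in_uniq ?idxs_uniq // => a b at_ bt e.
  by rewrite -(unnestK at_) e unnestK.
- by apply: cart_uniq; apply/allP => l /mapP[k _ ->]; exact: iota_uniq.
- move=> js; apply/mapP/idP => [[j jt ->]|jsf]; first exact: unnest_mem_fullidx.
  exists (nest t js); last by rewrite nestK.
  apply: nest_mem_idxs => l; rewrite mem_leaves => /andP[l0 ld].
  have [_ H] := mem_fullidx _ _ _ jsf; have := H l.-1; rewrite prednK //; exact.
Qed.

Lemma conservative_Ftop (R : realType) (F : R -> (seq nat -> R[i]) -> (seq nat -> R[i])) t0 t1 :
  (forall s, t0 <= s <= t1 -> forall Y : seq nat -> R[i],
     complex.Re (\sum_(js <- fullidx n d)
       conjc (Defs.mask n d Y js) * F s (Defs.mask n d Y) js) = 0) ->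
  conservative n t 1 (Ftop n d t F) t0 t1.
Proof.
(* The root rank is 1, so only the slice [c = 0] remains; it is read as a flat tensor through
   [nest]. *)
move=> H s sI Y; rewrite big_seq1.
rewrite -[RHS](H s sI (fun js => Y 0%N (nest t js))) -(perm_big _ perm_unnest) big_map.
congr complex.Re; rewrite big_seq [RHS]big_seq; apply: eq_bigr => j jt.
by rewrite /Ftop /= {2}/Defs.mask unnest_mem_fullidx // unnestK.
Qed.

End Identification.

Theorem theorem6p2 (R : realType) (d : nat) (n : nat -> nat) (taubar : Defs.tree)
    (F : R -> (seq nat -> R[i]) -> (seq nat -> R[i])) (t0 t1 : R)
    (Y0 Yh1 : Defs.ttn R) (Ch0 : Defs.ctens R) (calls : seq (Defs.tree * Defs.ttn R * Defs.ttn R)) :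
  Defs.tree_ok d taubar ->
  (* Re <Y, F(t,Y)> = 0 for all Y in C^{n_1 x ... x n_d} and all t in [t0,t1] *)
  (forall t, t0 <= t <= t1 -> forall Y : seq nat -> R[i],
     complex.Re (\sum_(js <- Defs.fullidx n d) conjc (Defs.mask n d Y js) * F t (Defs.mask n d Y) js) = 0) ->
  (* orthonormal starting TTN of full tree rank on taubar *)
  Defs.shape_ok taubar Y0 -> Defs.rk Y0 = 1%N -> Defs.full_tree_rank Y0 -> Defs.ttn_orth n taubar Y0 ->
  t0 < t1 ->
  Defs.run n taubar Y0 (Defs.Ftop n d taubar F) t0 t1 Yh1 Ch0 calls ->
  forall (tau : Defs.tree) (Y0tau Yh1tau : Defs.ttn R),
    List.In (tau, Y0tau, Yh1tau) calls ->
    Defs.tnorm n tau (Defs.rk Yh1tau) (Defs.full Yh1tau) = Defs.tnorm n tau (Defs.rk Y0tau) (Defs.full Y0tau).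
Proof.
move=> ok H _ rk1 fY _ t01 Hrun.
have cF := conservative_Ftop ok H; rewrite -rk1 in cF.
have [|ts [C1 [chh [_ _ [_ _ _ Hc]]]]] := run_norm t01 Hrun cF; last exact: Hc.
by move=> r C0 ch eY; apply: full_tree_rank_node; rewrite -eY.
Qed.
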